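(* For all integers $n\geq 1$ and all $x\in[0,1]$, $$F_{n+1}(x)\leq \frac{1+(4n-2)x(1-x)}{1+(4n+2)x(1-x)}\,F_{n-1}(x)$$ and $$F_{n}(x)\leq \frac{1+4nx(1-x)}{1+(4n+2)x(1-x)}\,F_{n-1}(x).$$
   Context: For integers $n\ge 0$ and $x\in[0,1]$ (with the convention $0^0=1$), $$F_n(x)=\sum_{k=0}^{n}\left(\binom{n}{k}x^{k}(1-x)^{n-k}\right)^{2}.$$ *)

(* Defs.v *)
From mathcomp Require Export all_boot all_order all_algebra.
From mathcomp Require Export reals.

Set Implicit Arguments.
Unset Strict Implicit.
Unset Printing Implicit Defensive.

Import GRing.Theory Num.Theory.
Local Open Scope ring_scope.

(* [x ^+ 0] is [1] for every [x], including [0]: this is the convention 0^0 = 1. *)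
Definition F (R : realType) (n : nat) (x : R) : R :=
  \sum_(0 <= k < n.+1) ('C(n, k)%:R * x ^+ k * (1 - x) ^+ (n - k)) ^+ 2.

(* Main.v *)
Require Import Defs.
From mathcomp Require Import all_boot all_order all_algebra.
From mathcomp Require Import reals.
From mathcomp Require Import ring lra.
Import Order.TTheory GRing.Theory Num.Theory.
Set Implicit Arguments.
Unset Strict Implicit.
Local Open Scope ring_scope.

(** Put [s = x (1 - x)].  Up to rescaling and a change of variable the
    [F n x] are Legendre polynomials, so they satisfy a three-term recurrence
    ([F_recurrence]):

      [(n + 2) F_(n+2) = (2n + 3) (1 - 2s) F_(n+1) - (n + 1) (1 - 4s) F_n].

    It comes from the homogeneous polynomials [sum_k C(n,k)^2 p^k q^(n-k)] at
    [p = x^2] and [q = (1 - x)^2], for which [p + q = 1 - 2s] and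
    [(p - q)^2 = 1 - 4s]; comparing coefficients reduces the recurrence to a
    quadratic relation between three consecutive binomial coefficients
    ([bin_three_term]).

    With [A = 1 + 4ns], [B = 1 + (4n - 2)s] and [D = 1 + (4n + 2)s], everything
    then rests on the polynomial identity

      [(2n + 1) (1 - 2s) A - n (1 - 4s) D = (n + 1) B].

    Inserting a bound [F_n <= A / D F_(n-1)] into the positive term of the
    recurrence gives exactly [F_(n+1) <= B / D F_(n-1)], so the second inequality
    implies the first ([F_two_step_bound]).  Inserting the same bound, read as
    [F_(n-1) >= D / A F_n], into the negative term gives
    [F_(n+1) <= B / A F_n], which is slightly stronger than the second inequality
    at [n + 1]; hence that one follows by induction ([F_ratio_bound]).  Both
    insertions keep the direction of the inequality because [0 <= 4s <= 1] on the
    unit interval. *)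

(** * Homogeneous binary forms *)

Section BinaryForms.
Variables (R : comNzRingType) (p q : R).

Definition binary_form (d : nat) (a : nat -> R) : R :=
  \sum_(0 <= k < d.+1) a k * p ^+ k * q ^+ (d - k).

Definition shift_coef (a : nat -> R) (k : nat) : R :=
  if k is j.+1 then a j else 0.

Lemma mul_binary_form_l d a :
  p * binary_form d a = binary_form d.+1 (shift_coef a).
Proof.
rewrite /binary_form [RHS]big_nat_recl //= !mul0r add0r mulr_sumr.
by apply: eq_bigr => k _; rewrite subSS exprS; ring.
Qed.

(** Raising the degree adds the monomial [p^(d+1)], which no multiple of [q]
    contains; hence the condition on [a]. *)
Lemma mul_binary_form_r d a : a d.+1 = 0 ->
  q * binary_form d a = binary_form d.+1 a.
Proof.
move=> ad0; rewrite /binary_form [RHS]big_nat_recr //= ad0 !mul0r addr0 mulr_sumr.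
by apply: eq_big_nat => k /andP[_ k_le]; rewrite subSn // exprS; ring.
Qed.

End BinaryForms.

(** * The three-term recurrence *)

(** For the coefficients [c] of [(1 + T)^m], the two-term relations
    [c_(k+1) (k + 1) = c_k (m - k)] and [c_(k+2) (k + 2) = c_(k+1) (m - k - 1)]
    express the outer coefficients through the middle one, after
    multiplication by [(k + 2) (m - k)]. *)
Lemma bin_three_term (R : numDomainType) (m k : nat) :
  (m%:R + 2) * 'C(m, k.+2)%:R * 'C(m, k)%:R
    + 'C(m, k.+1)%:R * ('C(m, k.+2)%:R + 'C(m, k)%:R)
  = m%:R * 'C(m, k.+1)%:R ^+ 2 :> R.
Proof.
case: (ltnP k m) => [k_lt|m_le]; last first.
  by rewrite !(@bin_small m _.+1) ?ltnS // 1?leqW //; ring.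
have [a ->] : exists a, m = (k.+1 + a)%N by exists (m - k.+1)%N; rewrite subnKC.
set m' := (k.+1 + a)%N.
have e1 : 'C(m', k)%:R * (a%:R + 1) = 'C(m', k.+1)%:R * (k%:R + 1) :> R.
  rewrite !natr1 -!natrM; congr _%:R.
  by rewrite mulnC [RHS]mulnC mul_bin_left /m' addSn -addnS addKn.
have e2 : 'C(m', k.+2)%:R * (k%:R + 2) = 'C(m', k.+1)%:R * a%:R :> R.
  rewrite -natrD addn2 -!natrM; congr _%:R.
  by rewrite mulnC [RHS]mulnC mul_bin_left /m' addKn.
have mE : m'%:R = k%:R + 1 + a%:R :> R by rewrite natrD -natr1.
apply: (@mulfI _ ((k%:R + 2) * (a%:R + 1) : R)).
  by rewrite mulf_neq0 // lt0r_neq0 // ltr_wpDl.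
rewrite mE; move: e1 e2.
set c0 : R := 'C(m', k)%:R; set c1 : R := 'C(m', k.+1)%:R.
set c2 : R := 'C(m', k.+2)%:R => e1 e2.
transitivity ((k%:R + 1 + a%:R + 2) * (c2 * (k%:R + 2)) * (c0 * (a%:R + 1))
   + c1 * ((c2 * (k%:R + 2)) * (a%:R + 1) + (k%:R + 2) * (c0 * (a%:R + 1)))).
  by ring.
by rewrite e1 e2; ring.
Qed.

Section SquaredBinomials.
Variable R : numDomainType.

Definition sqr_bin (n k : nat) : R := 'C(n, k)%:R ^+ 2.

(** By Pascal's rule both sides are quadratic forms in three consecutive
    coefficients of [(1 + T)^m]; their difference is twice the relation
    [bin_three_term]. *)
Lemma sqr_bin_recurrence m k :
  (m%:R + 2) * sqr_bin m.+2 k =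
    (2 * m%:R + 3) * (shift_coef (sqr_bin m.+1) k + sqr_bin m.+1 k)
    - (m%:R + 1) * (shift_coef (shift_coef (sqr_bin m)) k
                    - 2 * shift_coef (sqr_bin m) k + sqr_bin m k).
Proof.
rewrite /sqr_bin; case: k => [|[|k]] /=; first by rewrite !bin0; ring.
  by rewrite !bin1 !bin0 -!natr1; ring.
rewrite !binS !natrD.
have := bin_three_term R m k.
set c0 : R := 'C(m, k)%:R; set c1 : R := 'C(m, k.+1)%:R.
set c2 : R := 'C(m, k.+2)%:R => rel.
apply/eqP; rewrite -subr_eq0; apply/eqP.
transitivity (2 * (((m%:R + 2) * c2 * c0 + c1 * (c2 + c0)) - m%:R * c1 ^+ 2)).
  by ring.
by rewrite rel subrr mulr0.
Qed.

Lemma sqr_bin_form_recurrence (p q : R) m :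
  (m%:R + 2) * binary_form p q m.+2 (sqr_bin m.+2) =
    (2 * m%:R + 3) * (p + q) * binary_form p q m.+1 (sqr_bin m.+1)
    - (m%:R + 1) * (p - q) ^+ 2 * binary_form p q m (sqr_bin m).
Proof.
have sqr_bin_gt n j : (n < j)%N -> sqr_bin n j = 0.
  by move=> n_lt; rewrite /sqr_bin bin_small // expr0n.
set g1 := binary_form p q m.+1 _; set g0 := binary_form p q m _.
(* Every product is a form of degree m + 2, so coefficients can be compared. *)
transitivity ((2 * m%:R + 3) * (p * g1 + q * g1)
  - (m%:R + 1) * (p * (p * g0) - 2 * (q * (p * g0)) + q * (q * g0))); last by ring.
rewrite !mul_binary_form_l !mul_binary_form_r //= ?sqr_bin_gt //.
rewrite /binary_form !(mulr_sumr, =^~ sumrB, =^~ big_split) /=.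
by apply: eq_bigr => k _; rewrite -[_ * _ * _ in LHS]mulrA [LHS]mulrA sqr_bin_recurrence; ring.
Qed.

End SquaredBinomials.

Lemma F_binary_form (R : realType) n (x : R) :
  F n x = binary_form (x ^+ 2) ((1 - x) ^+ 2) n (sqr_bin R n).
Proof.
by apply: eq_bigr => k _; rewrite ![in LHS]exprMn (exprAC x) (exprAC (1 - x)).
Qed.

Lemma F_recurrence (R : realType) n (x : R) :
  (n%:R + 2) * F n.+2 x =
    (2 * n%:R + 3) * (1 - 2 * (x * (1 - x))) * F n.+1 x
    - (n%:R + 1) * (1 - 4 * (x * (1 - x))) * F n x.
Proof. by rewrite !F_binary_form sqr_bin_form_recurrence; ring. Qed.

(** * The bounds *)

Lemma F_ge0 (R : realType) n (x : R) : 0 <= F n x.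
Proof. by apply: sumr_ge0 => k _; apply: sqr_ge0. Qed.

Section Bounds.
Variables (R : realType) (x : R).
Hypothesis x01 : 0 <= x <= 1.
Let s := x * (1 - x).

Let s_ge0 : 0 <= s.
Proof. by case/andP: x01 => ? ?; rewrite mulr_ge0 // subr_ge0. Qed.

Let s_le : 0 <= 1 - 4 * s.
Proof. by have := sqr_ge0 (1 - 2 * x); rewrite /s; lra. Qed.

(** The division-free form of the second inequality, at index [n + 1].  In the
    induction step [A], [B] are the quantities of the overview at index [n + 1],
    and [step] is the sharper bound [F_(n+2) <= B / A F_(n+1)]. *)
Lemma F_ratio_bound n :
  (1 + (4 * n%:R + 6) * s) * F n.+1 x <= (1 + (4 * n%:R + 4) * s) * F n x.
Proof.
elim: n => [|n IHn].
  rewrite /F !big_nat_recr //= !big_geq // !bin0 bin1 /s.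
  have := sqr_ge0 s; rewrite /s !(expr0, expr1, subnn, subn0); lra.
have n_ge0 : 0 <= n%:R :> R by [].
have ns_ge0 : 0 <= n%:R * s by rewrite mulr_ge0.
have rec := F_recurrence n x; rewrite -/s in rec.
have f1_ge0 := F_ge0 n.+1 x.
rewrite -[n.+1%:R]natr1; move: rec IHn f1_ge0.
set f0 := F n x; set f1 := F n.+1 x; set f2 := F n.+2 x => rec IHn f1_ge0.
pose A := 1 + (4 * n%:R + 4) * s.
pose B := 1 + (4 * n%:R + 2) * s.
have A_gt0 : 0 < A by rewrite /A; have := s_ge0; lra.
have n2_gt0 : 0 < n%:R + 2 :> R by lra.
have step : A * f2 <= B * f1.
  rewrite -(ler_pM2l n2_gt0) -subr_ge0.
  have -> : (n%:R + 2) * (B * f1) - (n%:R + 2) * (A * f2) =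
    (n%:R + 1) * (1 - 4 * s) * (A * f0 - (1 + (4 * n%:R + 6) * s) * f1).
    by rewrite [X in _ - X]mulrCA rec /A /B; ring.
  apply: mulr_ge0; last by rewrite subr_ge0.
  by apply: mulr_ge0 => //; lra.
rewrite -(ler_pM2l A_gt0).
have D_ge0 : 0 <= 1 + (4 * n%:R + 10) * s by have := s_ge0; lra.
apply: (@le_trans _ _ ((1 + (4 * n%:R + 10) * s) * (B * f1))).
  have := ler_wpM2l D_ge0 step; lra.
(* With A' and D' the values of A and D at the next index, A A' - B D' = 12 s^2. *)
rewrite -subr_ge0.
have -> : A * ((1 + (4 * (n%:R + 1) + 4) * s) * f1)
   - (1 + (4 * n%:R + 10) * s) * (B * f1) = 12 * s ^+ 2 * f1.
  by rewrite /A /B; ring.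
by rewrite mulr_ge0 // mulr_ge0 // sqr_ge0.
Qed.

(** [F_(n+1)] enters the recurrence for [F_(n+2)] with the nonnegative factor
    [(2n + 3) (1 - 2s)], so [F_ratio_bound] may be substituted there; the
    coefficient of [F_n] then simplifies by the identity of the overview. *)
Lemma F_two_step_bound n :
  (1 + (4 * n%:R + 6) * s) * F n.+2 x <= (1 + (4 * n%:R + 2) * s) * F n x.
Proof.
have n_ge0 : 0 <= n%:R :> R by [].
have n2_gt0 : 0 < n%:R + 2 :> R by lra.
rewrite -(ler_pM2l n2_gt0) -subr_ge0.
have rec := F_recurrence n x; rewrite -/s in rec.
rewrite [X in _ - X]mulrCA rec.
have a_ge0 : 0 <= (2 * n%:R + 3) * (1 - 2 * s).
  by apply: mulr_ge0; have := s_ge0; have := s_le; lra.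
have := F_ratio_bound n; rewrite -subr_ge0 => /(mulr_ge0 a_ge0).
by congr (0 <= _); ring.
Qed.

End Bounds.

Unset Implicit Arguments.
Set Strict Implicit.

Theorem theorem4 (R : realType) (n : nat) (x : R)
    (hn : (1 <= n)%N) (hx : 0 <= x <= 1) :
  F n.+1 x <=
    (1 + (4 * n%:R - 2) * x * (1 - x)) / (1 + (4 * n%:R + 2) * x * (1 - x))
      * F n.-1 x
  /\
  F n x <=
    (1 + 4 * n%:R * x * (1 - x)) / (1 + (4 * n%:R + 2) * x * (1 - x))
      * F n.-1 x.
Proof.
case: n hn => // n _ /=.
have s_ge0 : 0 <= x * (1 - x).
  by case/andP: hx => ? ?; rewrite mulr_ge0 // subr_ge0.
have ns_ge0 : 0 <= n%:R * (x * (1 - x)) by rewrite mulr_ge0.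
have D_gt0 : 0 < 1 + (4 * n.+1%:R + 2) * x * (1 - x) by rewrite -[n.+1%:R]natr1; lra.
split; rewrite mulrAC ler_pdivlMr // mulrC -[n.+1%:R]natr1.
- have := F_two_step_bound hx n; congr (_ <= _); ring.
- have := F_ratio_bound hx n; congr (_ <= _); ring.
Qed.
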